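(* For every $d\in(0,1)$, writing $m:=\lceil n(1-d)\rceil$ for each $n\ge1$, the capacity $C(d)$ of the binary deletion channel with deletion probability $d$ satisfies $$C(d)\ \le\ \liminf_{n\to\infty}\ \frac1n\log\Big(\sum_{\mathbf{y}\in\{0,1\}^m}\ \max_{\mathbf{x}\in\{0,1\}^n}\#(\mathbf{x},\mathbf{y})\Big)\;-\;h(d),$$ where $h(d)=-d\log d-(1-d)\log(1-d)$.
   Context: Logarithms are base 2. In the binary deletion channel with deletion probability $d$, each bit of an input $\mathbf{x}\in\{0,1\}^n$ is deleted independently with probability $d$, and the output $\mathbf{Y}$ is the sequence of remaining bits in order (of random length). For each $n$, $C_n(d)=\frac1n\sup_{\mathbf{X}^n}I(\mathbf{X}^n;\mathbf{Y}(\mathbf{X}^n))$, the supremum over all distributions of the input $\mathbf{X}^n$ on $\{0,1\}^n$; the capacity is $C(d)=\liminf_{n\to\infty}C_n(d)$. For $\mathbf{x}\in\{0,1\}^n$ and $\mathbf{y}\in\{0,1\}^m$, the number of deletion patterns $\#(\mathbf{x},\mathbf{y})$ is the number of $\mathbf{d}\in\{0,1\}^n$ such that deleting from $\mathbf{x}$ exactly the coordinates $i$ with $d_i=1$ leaves $\mathbf{y}$; i.e. the number of occurrences of $\mathbf{y}$ as a (not necessarily contiguous) subsequence of $\mathbf{x}$, counted by positions. *)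

(* Defs.v *)
(* MathComp / MathComp-Analysis *)
From HB Require Import structures.
From mathcomp Require Export all_boot all_order all_algebra.
From mathcomp Require Export all_classical all_reals all_analysis.

Set Implicit Arguments.
Unset Strict Implicit.
Unset Printing Implicit Defensive.

Import Order.TTheory GRing.Theory Num.Theory.

Local Open Scope classical_set_scope.
Local Open Scope ring_scope.

Definition log2 (R : realType) (x : R) : R := ln x / ln 2.

Definition binary_entropy (R : realType) (d : R) : R :=
  - d * log2 d - (1 - d) * log2 (1 - d).

Definition is_pmf (R : realType) (A : finType) (P : A -> R) : Prop :=
  (forall a, 0 <= P a) /\ \sum_(a : A) P a = 1.

Definition joint_pmf (R : realType) (A B : finType) (P : A -> R)
    (W : A -> B -> R) (a : A) (b : B) : R := P a * W a b.

(* Since [ln 0 = 0] and [0 / 0 = 0] in the library, the terms of zero joint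
   probability vanish, which is the convention 0 log 0 = 0. *)
Definition mutual_info (R : realType) (A B : finType) (J : A -> B -> R) : R :=
  \sum_(a : A) \sum_(b : B)
    J a b * log2 (J a b / ((\sum_(b' : B) J a b') * (\sum_(a' : A) J a' b))).

(* The bit of [e] at a position is [true] when that position is deleted,
   whereas [mask] keeps the positions marked [true]. *)
Definition delete_bits (n : nat) (e x : n.-tuple bool) : seq bool :=
  mask (map negb e) x.

Definition pattern_prob (R : realType) (d : R) (n : nat) (e : n.-tuple bool) : R :=
  \prod_(i < n) bernoulli_pmf d (tnth e i).

(* The output has random length at most [n], so its alphabet is the finite type
   of bit sequences of length at most [n]. *)
Definition deletion_channel (R : realType) (d : R) (n : nat)
    (x : n.-tuple bool) (y : n.-bseq bool) : R :=
  \sum_(e : n.-tuple bool | delete_bits e x == y :> seq bool) pattern_prob d e.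

(* The value at [n = 0] is irrelevant: only the limit inferior in [n] is used. *)
Definition block_capacity (R : realType) (d : R) (n : nat) : \bar R :=
  ((n%:R^-1)%:E *
   ereal_sup [set (mutual_info (joint_pmf P (@deletion_channel R d n)))%:E
             | P in [set P : n.-tuple bool -> R | is_pmf P]])%E.

Definition deletion_capacity (R : realType) (d : R) : \bar R :=
  limn_einf (block_capacity d).

Definition num_patterns (n m : nat) (x : n.-tuple bool) (y : m.-tuple bool) : nat :=
  #|[set e : n.-tuple bool | delete_bits e x == y :> seq bool]|.

(* ceil(n (1 - d)); [absz] only converts from [int], the argument being
   nonnegative for [d <= 1]. *)
Definition typical_length (R : realType) (d : R) (n : nat) : nat :=
  `|Num.ceil (n%:R * (1 - d))|%N.

(* Main.v *)
Require Import Defs.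
From mathcomp Require Import all_boot all_order all_algebra.
From mathcomp Require Import all_classical all_reals all_analysis.
From mathcomp Require Import ring lra zify.
Import Order.TTheory GRing.Theory Num.Theory.
Local Open Scope classical_set_scope.
Local Open Scope ring_scope.

(* For any output distribution Q, I(X;Y) is at most the maximum over x of the
   divergence of W(.|x) from Q.  Write M(y) for the maximum over x of #(x,y) and
   S(k) for the sum of M over {0,1}^k, and let Q pick a length k in 0..n
   uniformly, then y of length k with probability M(y) / S(k).
   As W(y|x) = #(x,y) d^(n-k) (1-d)^k, this gives
     I(X;Y) <= log (n+1) + E[log S(K)] - n h(d),   K ~ Bin(n, 1-d).
   Dropping the first bit of y gives S(k+1) <= 2n S(k), and inserting a bit gives
   S(k) <= n S(k+1), so |log S(k) - log S(m)| <= |k - m| log (2n); since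
   E|K - m| = O(sqrt n), E[log S(K)] differs from log S(m) by o(n). *)

Lemma big_bool_tupleS {T : Type} {idx : T} (op : Monoid.com_law idx) (n : nat)
    (F : n.+1.-tuple bool -> T) :
  \big[op/idx]_(t : n.+1.-tuple bool) F t =
  op (\big[op/idx]_(t : n.-tuple bool) F (cons_tuple true t))
     (\big[op/idx]_(t : n.-tuple bool) F (cons_tuple false t)).
Proof.
rewrite (reindex (fun p : bool * n.-tuple bool => cons_tuple p.1 p.2)) /=.
  rewrite -(pair_big xpredT xpredT (fun b t => F (cons_tuple b t))) /=.
  by rewrite big_bool.
exists (fun t : n.+1.-tuple bool => (thead t, [tuple of behead t])).
  by move=> [b t] _; congr pair; apply: val_inj.
by move=> t _; rewrite [RHS]tuple_eta; apply: val_inj.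
Qed.

(** * Counting occurrences *)

Section Combinatorics.
Local Open Scope nat_scope.

(** This is #(x,y) by recursion on the first bit of [x], either deleted or matched with the first
    bit of [y]. Plain sequences spare the inductions any length index. *)
Fixpoint occurrences (x y : bitseq) : nat :=
  match x, y with
  | _, [::] => 1
  | [::], _ :: _ => 0
  | a :: x', b :: y' => occurrences x' y + (a == b) * occurrences x' y'
  end.

Lemma occurrences_nil (x : bitseq) : occurrences x [::] = 1.
Proof. by case: x. Qed.

(** Patterns are split by their first bit: [true] deletes the first bit of [x] and leaves [y] to be
    found in the rest, [false] forces it to be the first bit of [y]. *)
Lemma card_delete_bits (n : nat) (x : n.-tuple bool) (y : bitseq) :
  #|[pred e : n.-tuple bool | delete_bits e x == y]| = occurrences x y.
Proof.
rewrite -sum1_card big_mkcond /=.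
elim: n x y => [|n IH] x y.
  rewrite (big_pred1 [tuple]) => [|e]; last by apply/esym/eqP; exact: tuple0.
  by rewrite (tuple0 x) !inE; case: y.
case/tupleP: x => a x; rewrite big_bool_tupleS /=.
have -> : \sum_(t : n.-tuple bool) (if cons_tuple true t \in
    [pred e | delete_bits e [tuple of a :: x] == y :> seq bool] then 1 else 0)
  = occurrences x y.
  by rewrite -IH; apply: eq_bigr.
case: y => [|b y].
  rewrite occurrences_nil big1 // => t _.
have [-> | ab] := eqVneq a b.
  rewrite mul1n; congr (_ + _); rewrite -IH; apply: eq_bigr => t _.
  by rewrite !inE /delete_bits /= eqseq_cons eqxx.
rewrite mul0n big1 ?addn0 // => t _.
by rewrite !inE /delete_bits /= eqseq_cons (negbTE ab).
Qed.

Lemma num_patternsE (n m : nat) (x : n.-tuple bool) (y : m.-tuple bool) :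
  num_patterns x y = occurrences x y.
Proof.
rewrite -card_delete_bits; apply: eq_card => e.
by apply/idP/idP; rewrite [_ \in pred_of_simpl _]inE in_setE.
Qed.

Lemma occurrences_consl (a : bool) (x y : bitseq) :
  occurrences x y <= occurrences (a :: x) y.
Proof. by case: y => [|b y]; rewrite ?occurrences_nil //= leq_addr. Qed.

(** An occurrence of [b :: y] is fixed by the position of [b], for which there are at most [size x]
    choices, and by the occurrence of [y] that follows. *)
Lemma occurrences_consr (x : bitseq) (b : bool) (y : bitseq) :
  occurrences x (b :: y) <= size x * occurrences x y.
Proof.
elim: x => [//|a x IH] /=; rewrite -/(occurrences (a :: x) y).
apply: leq_trans (leq_mul (leqnn _) (occurrences_consl a x y)).
by rewrite mulSn addnC leq_add //; case: (a == b); rewrite ?mul1n.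
Qed.

(** * Maximal occurrence counts and their sums over words of one length *)

Definition max_occurrences (n : nat) (y : bitseq) : nat :=
  \max_(x : n.-tuple bool) occurrences x y.

Lemma leq_max_occurrences (n : nat) (x y : bitseq) :
  size x = n -> occurrences x y <= max_occurrences n y.
Proof.
move=> /eqP sx.
exact: (leq_bigmax (F := fun t : n.-tuple bool => occurrences t y) (Tuple sx)).
Qed.

Lemma max_occurrences_consr (n : nat) (b : bool) (y : bitseq) :
  max_occurrences n (b :: y) <= n * max_occurrences n y.
Proof.
apply/bigmax_leqP => x _; apply: leq_trans (occurrences_consr _ _ _) _.
by rewrite size_tuple leq_mul // leq_max_occurrences // size_tuple.
Qed.

(** Prepending [a] to a maximizing [x] keeps every occurrence, with the new bit matched to [a]. *)
Lemma max_occurrences_cons2 (n : nat) (a : bool) (y : bitseq) :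
  max_occurrences n y <= max_occurrences n.+1 (a :: y).
Proof.
apply/bigmax_leqP => x _.
apply: leq_trans (leq_max_occurrences n.+1 (a :: x) _ _) => /=.
  by rewrite eqxx mul1n leq_addl.
by rewrite size_tuple.
Qed.

Definition insert_bit (j : nat) (y : bitseq) : bitseq :=
  take j y ++ true :: drop j y.

(* Turning the first deleted position of a pattern into a kept [true] yields a
   pattern of a word obtained by inserting one [true] into [y]. *)
Lemma max_occurrences_insert (n : nat) (y : bitseq) : size y < n ->
  max_occurrences n y <=
  \sum_(j < (size y).+1) max_occurrences n (insert_bit j y).
Proof.
move=> yn; apply/bigmax_leqP => -[x /= /eqP xn] _.
elim: n x y xn yn => [//|n IH] [//|a x] y [xn] yn.
rewrite big_ord_recl {1}/insert_bit take0 drop0 /=.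
(* Patterns that delete [a] are charged to the insertion at position 0: with [a] replaced by [true]
   and kept, they produce [true :: y]. *)
have h0 : occurrences x y <= max_occurrences n.+1 (true :: y).
  by apply: leq_trans (max_occurrences_cons2 _ _ _); exact: leq_max_occurrences.
case: y yn h0 => [|b y] yn h0.
  by rewrite (leq_trans _ (leq_addr _ _)) // -(occurrences_nil x).
(* Patterns that keep [a] are charged to the later insertions: inserting at [j.+1] in [b :: y] is
   inserting at [j] in [y], then prepending [b]. *)
rewrite leq_add //; case: eqVneq => // <-; rewrite mul1n.
apply: leq_trans (IH x y xn yn) _; apply: leq_sum => j _.
exact: max_occurrences_cons2.
Qed.

Definition max_sum (n k : nat) : nat :=
  \sum_(y : k.-tuple bool) max_occurrences n y.

Lemma max_sumS_le (n k : nat) : max_sum n k.+1 <= n.*2 * max_sum n k.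
Proof.
rewrite /max_sum big_bool_tupleS /= -addnn mulnDl !big_distrr /=.
by apply: leq_add; apply: leq_sum => y _; exact: max_occurrences_consr.
Qed.

Lemma size_insert_bit (k j : nat) (y : k.-tuple bool) :
  size (insert_bit j y) == k.+1.
Proof. by rewrite size_cat /= addnS -size_cat cat_take_drop size_tuple. Qed.

Lemma insert_bit_inj (j : nat) (y z : bitseq) :
  j <= size y -> j <= size z -> insert_bit j y = insert_bit j z -> y = z.
Proof.
move=> jy jz /eqP; rewrite eqseq_cat ?size_takel // eqseq_cons eqxx /=.
by case/andP => /eqP e1 /eqP e2; rewrite -(cat_take_drop j y) e1 e2 cat_take_drop.
Qed.

(** For each fixed position [j], insertion is injective on words of length [k], so its contribution
    is a partial sum of [max_sum n k.+1]. There are [k.+1 <= n] positions. *)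
Lemma max_sum_leS (n k : nat) : k < n -> max_sum n k <= n * max_sum n k.+1.
Proof.
move=> kn; apply: (@leq_trans (\sum_(y : k.-tuple bool) \sum_(j < k.+1)
    max_occurrences n (insert_bit j y))).
  apply: leq_sum => y _; have := @max_occurrences_insert n y.
  by rewrite size_tuple => /(_ kn).
rewrite exchange_big /=.
apply: (@leq_trans (\sum_(j < k.+1) max_sum n k.+1)); last first.
  by rewrite sum_nat_const card_ord leq_mul2r kn orbT.
apply: leq_sum => j _.
pose f (y : k.-tuple bool) := Tuple (size_insert_bit k j y).
have finj : injective f.
  move=> y z [] /insert_bit_inj e; apply: val_inj; apply: e;
  by rewrite size_tuple -ltnS.
have -> : \sum_(y : k.-tuple bool) max_occurrences n (insert_bit j y) =
    \sum_(z in f @: predT) max_occurrences n z.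
  rewrite big_imset /=; last by move=> y z _ _; exact: finj.
  by [].
by rewrite /max_sum [leqRHS](bigID (mem (f @: predT))) leq_addr.
Qed.

Lemma max_sum_gt0 (n k : nat) : k <= n -> 0 < max_sum n k.
Proof.
elim: k => [_|k IH kn].
  rewrite /max_sum (bigD1 [tuple]) //= ltn_addr //.
  apply: leq_trans (leq_max_occurrences n (nseq n true) _ (size_nseq _ _)).
  by rewrite occurrences_nil.
by have := leq_trans (IH (ltnW kn)) (max_sum_leS _ _ kn); rewrite muln_gt0; case/andP.
Qed.

(** Subtraction is truncated, so [(k - m) + (m - k)] is the distance of [k] and [m]. Each unit step
    costs a factor of at most [2n] in either direction. *)
Lemma max_sum_lipschitz (n k m : nat) : k <= n -> m <= n ->
  max_sum n k <= n.*2 ^ ((k - m) + (m - k)) * max_sum n m.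
Proof.
move=> kn mn; have [mk|/ltnW km] := leqP m k.
  have -> : m - k = 0 by lia.
  rewrite addn0 -[in max_sum n k](subnK mk).
  elim: (k - m) => [|r IH]; first by rewrite expn0 mul1n.
  rewrite addSn (leq_trans (max_sumS_le _ _)) // expnS -mulnA.
  by rewrite leq_mul2l IH orbT.
have -> : k - m = 0 by lia.
rewrite add0n -[in max_sum n m](subnK km).
move: mn; rewrite -[in leqLHS](subnK km).
elim: (m - k) => [|r IH] rn; first by rewrite expn0 mul1n.
apply: leq_trans (IH _) _; first exact: ltnW.
rewrite expnSr -mulnA leq_mul2l addSn; apply/orP; right.
by rewrite (leq_trans (max_sum_leS _ _ _)) // leq_mul2r -addnn leq_addr orbT.
Qed.

End Combinatorics.

(** * The output of the deletion channel *)

Lemma size_delete_bits {n : nat} (e x : n.-tuple bool) :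
  size (delete_bits e x) = count negb e.
Proof. by rewrite size_mask ?size_map ?size_tuple // count_map. Qed.

Lemma pattern_prob_cons {R : realType} (d : R) (n : nat) (b : bool)
    (e : n.-tuple bool) :
  pattern_prob d (cons_tuple b e) = bernoulli_pmf d b * pattern_prob d e.
Proof.
rewrite /pattern_prob big_ord_recl tnth0; congr (_ * _).
by apply: eq_bigr => i _; rewrite tnthS.
Qed.

(** Since [true] marks a deletion, [count negb e] is the number of kept bits, each of probability
    [1 - d]. *)
Lemma pattern_probE {R : realType} (d : R) (n : nat) (e : n.-tuple bool) :
  pattern_prob d e = d ^+ (n - count negb e) * (1 - d) ^+ count negb e.
Proof.
elim: n e => [|n IH] e; first by rewrite tuple0 /pattern_prob big_ord0 mulr1.
case/tupleP: e => b e; rewrite pattern_prob_cons IH.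
have ce : (count negb e <= n)%N by rewrite -[leqRHS](size_tuple e) count_size.
case: b => /=; first by rewrite add0n subSn // exprS mulrA.
by rewrite add1n subSS exprS /bernoulli_pmf mulrCA.
Qed.

(** The expectation of [g(K)] for [K] binomial with parameters [n] and [1 - d]. Summing over
    patterns avoids binomial coefficients and gives a recursion on the first bit. *)
Definition pattern_mean {R : realType} (d : R) (n : nat) (g : nat -> R) : R :=
  \sum_(e : n.-tuple bool) pattern_prob d e * g (count negb e).

Lemma pattern_mean0 {R : realType} (d : R) (g : nat -> R) :
  pattern_mean d 0 g = g 0%N.
Proof.
rewrite /pattern_mean (big_pred1 [tuple]) => [|e].
  by rewrite /pattern_prob big_ord0 mul1r.
by apply/esym/eqP; exact: tuple0.
Qed.

Lemma pattern_meanS {R : realType} (d : R) (n : nat) (g : nat -> R) :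
  pattern_mean d n.+1 g =
  d * pattern_mean d n g + (1 - d) * pattern_mean d n (fun k => g k.+1).
Proof.
rewrite /pattern_mean big_bool_tupleS !mulr_sumr /=.
by congr (_ + _); apply: eq_bigr => e _; rewrite pattern_prob_cons mulrA.
Qed.

Lemma pattern_mean_affine {R : realType} (d : R) (n : nat) (a b : R) :
  pattern_mean d n (fun k => a * k%:R + b) = a * (n%:R * (1 - d)) + b.
Proof.
elim: n b => [|n IH] b; first by rewrite pattern_mean0; ring.
rewrite pattern_meanS IH.
rewrite (_ : (fun k => a * k.+1%:R + b) = (fun k => a * k%:R + (a + b))).
  by rewrite IH -[n.+1%:R]natr1; ring.
by apply/funext => k; rewrite -natr1; ring.
Qed.

(** Variance plus squared bias. The center [c] stays free in the induction because a kept first bit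
    shifts it to [c - 1]. *)
Lemma pattern_mean_sqr {R : realType} (d : R) (n : nat) (c : R) :
  pattern_mean d n (fun k => (k%:R - c) ^+ 2) =
  n%:R * d * (1 - d) + (n%:R * (1 - d) - c) ^+ 2.
Proof.
elim: n c => [|n IH] c; first by rewrite pattern_mean0; ring.
rewrite pattern_meanS IH.
rewrite (_ : (fun k => (k.+1%:R - c) ^+ 2) = (fun k => (k%:R - (c - 1)) ^+ 2)).
  by rewrite IH -[n.+1%:R]natr1; ring.
by apply/funext => k; rewrite -natr1; ring.
Qed.

Lemma pattern_prob_ge0 {R : realType} {d : R} {n : nat} (e : n.-tuple bool) :
  0 <= d <= 1 -> 0 <= pattern_prob d e.
Proof. by move=> d01; apply: prodr_ge0 => i _; exact: bernoulli_pmf_ge0. Qed.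

Lemma le_pattern_mean {R : realType} (d : R) (n : nat) (f g : nat -> R) :
  0 <= d <= 1 -> (forall k, (k <= n)%N -> f k <= g k) ->
  pattern_mean d n f <= pattern_mean d n g.
Proof.
move=> d01 fg; apply: ler_sum => e _; apply: ler_wpM2l.
  exact: pattern_prob_ge0.
by apply: fg; rewrite -[leqRHS](size_tuple e) count_size.
Qed.

Lemma pattern_meanD {R : realType} (d : R) (n : nat) (f g : nat -> R) :
  pattern_mean d n (fun k => f k + g k) =
  pattern_mean d n f + pattern_mean d n g.
Proof.
by rewrite /pattern_mean -big_split; apply: eq_bigr => e _; rewrite mulrDr.
Qed.

Lemma pattern_meanZ {R : realType} (d : R) (n : nat) (c : R) (f : nat -> R) :
  pattern_mean d n (fun k => c * f k) = c * pattern_mean d n f.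
Proof.
by rewrite /pattern_mean mulr_sumr; apply: eq_bigr => e _; rewrite mulrCA.
Qed.

Lemma deletion_channelE {R : realType} (d : R) (n : nat) (x : n.-tuple bool)
    (y : n.-bseq bool) :
  deletion_channel d x y =
  (occurrences x y)%:R * (d ^+ (n - size y) * (1 - d) ^+ size y).
Proof.
rewrite -card_delete_bits mulr_natl -sumr_const; apply: eq_bigr => e /eqP <-.
by rewrite pattern_probE size_delete_bits.
Qed.

Lemma deletion_channel_ge0 {R : realType} {d : R} {n : nat}
    (x : n.-tuple bool) (y : n.-bseq bool) :
  0 <= d <= 1 -> 0 <= deletion_channel d x y.
Proof. by move=> d01; apply: sumr_ge0 => e _; exact: pattern_prob_ge0. Qed.

(** Grouping the patterns by their output shows that the output length has the same binomial law for
    every input [x]. *)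
Lemma deletion_channel_mean {R : realType} (d : R) {n : nat}
    (x : n.-tuple bool) (g : nat -> R) :
  \sum_(y : n.-bseq bool) deletion_channel d x y * g (size y) =
  pattern_mean d n g.
Proof.
have sz (e : n.-tuple bool) : (size (delete_bits e x) <= n)%N.
  by rewrite size_delete_bits -[leqRHS](size_tuple e) count_size.
rewrite /pattern_mean.
rewrite (partition_big (fun e => Bseq (sz e)) xpredT) //=.
apply: eq_bigr => y _; rewrite mulr_suml.
by apply: eq_bigr => e /eqP <-; rewrite -(size_delete_bits e x).
Qed.

Lemma sum_bseq {R : nmodType} (n : nat) (F : bitseq -> R) :
  \sum_(y : n.-bseq bool) F y =
  \sum_(k < n.+1) \sum_(y : k.-tuple bool) F y.
Proof.
rewrite (reindex (@tagged_tuple_bseq n bool)) /=; last exact: onW_bij.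
rewrite (sig_big_dep xpredT (fun _ _ => true)
  (fun (k : 'I_n.+1) (y : k.-tuple bool) => F y)) /=.
exact: eq_bigr.
Qed.

(** * Bounding the mutual information *)

Lemma ln2_gt0 {R : realType} : 0 < ln 2 :> R.
Proof. by rewrite ln_gt0 // ltr1n. Qed.

Lemma log2M {R : realType} (x y : R) :
  0 < x -> 0 < y -> log2 (x * y) = log2 x + log2 y.
Proof. by move=> x0 y0; rewrite /log2 lnM ?posrE // mulrDl. Qed.

Lemma log2X {R : realType} (x : R) (n : nat) :
  0 < x -> log2 (x ^+ n) = n%:R * log2 x.
Proof. by move=> x0; rewrite /log2 lnXn // !mulrnAl mul1r. Qed.

Lemma le_log2 {R : realType} (x y : R) : 0 < x -> x <= y -> log2 x <= log2 y.
Proof.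
move=> x0 xy; rewrite /log2 ler_wpM2r ?invr_ge0 ?(ltW ln2_gt0) //.
by rewrite ler_ln ?posrE // (lt_le_trans x0).
Qed.

Lemma log2_le_subr1 {R : realType} (x : R) :
  0 < x -> log2 x <= (ln 2)^-1 * (x - 1).
Proof.
move=> x0; rewrite /log2 mulrC ler_wpM2l ?invr_ge0 ?(ltW ln2_gt0) //.
by have := @le_ln1Dx R (x - 1); rewrite [1 + _]addrC subrK; apply; lra.
Qed.

(* The gap between the two sides is the divergence from [Q] of the output
   distribution induced by [P]. *)
Lemma mutual_info_le {R : realType} {A B : finType} (P : A -> R)
    (W : A -> B -> R) (Q : B -> R) :
  is_pmf P -> (forall a b, 0 <= W a b) -> (forall a, \sum_(b : B) W a b = 1) ->
  (forall b, 0 <= Q b) -> \sum_(b : B) Q b <= 1 ->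
  (forall a b, 0 < W a b -> 0 < Q b) ->
  mutual_info (joint_pmf P W) <=
  \sum_(a : A) P a * \sum_(b : B) W a b * log2 (W a b / Q b).
Proof.
move=> [P0 P1] W0 W1 Q0 Q1 WQ.
pose q b := \sum_(a : A) P a * W a b.
have q0 b : 0 <= q b by apply: sumr_ge0 => a _; rewrite mulr_ge0.
(* Applying [ln u <= u - 1] to [u = Q b / q b], weighted by the joint probability, leaves the
   remainder [D a b]. Its total is at most 0, since [Q] has mass at most 1 and the joint
   distribution has mass 1. *)
pose D a b := P a * W a b / q b * Q b - P a * W a b.
have D0 : \sum_(a : A) \sum_(b : B) D a b <= 0.
  under eq_bigr do rewrite sumrB.
  rewrite sumrB exchange_big /=.
  rewrite [X in _ - X](_ : _ = 1); last first.
    by rewrite -P1; apply: eq_bigr => a _; rewrite -mulr_sumr W1 mulr1.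
  rewrite subr_le0; apply: le_trans Q1; apply: ler_sum => b _.
  (* Where [q b = 0], division by zero yields 0, which is still at most [Q b]. *)
  rewrite -!mulr_suml -/(q b); have [->|qb] := eqVneq (q b) 0.
    by rewrite invr0 mulr0 mul0r.
  by rewrite divff // mul1r.
apply: (@le_trans _ _ (\sum_(a : A) \sum_(b : B)
    (P a * (W a b * log2 (W a b / Q b)) + (ln 2)^-1 * D a b))); last first.
  under eq_bigr do rewrite big_split /= -!mulr_sumr.
  rewrite big_split /= -mulr_sumr gerDl.
  by rewrite mulr_ge0_le0 // invr_ge0 ltW // ln2_gt0.
apply: ler_sum => a _; apply: ler_sum => b _.
rewrite /joint_pmf -mulr_sumr W1 mulr1 -/(q b).
have [J0|J0] := eqVneq (P a * W a b) 0.
  by rewrite /D mulrA J0 !mul0r subrr mulr0 addr0.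
have [Pa Wab] : 0 < P a /\ 0 < W a b.
  move: J0; rewrite mulf_eq0 negb_or => /andP[Pa Wab].
  by rewrite !lt_neqAle !(eq_sym 0) Pa Wab P0 W0.
have qb : 0 < q b.
  apply: (@lt_le_trans _ _ (P a * W a b)); first exact: mulr_gt0.
  rewrite /q (bigD1 a) //= lerDl.
  by apply: sumr_ge0 => a' _; rewrite mulr_ge0.
have Qb := WQ _ _ Wab.
have -> : P a * W a b / (P a * q b) = W a b / Q b * (Q b / q b).
  by field; rewrite !gt_eqF.
rewrite log2M ?divr_gt0 // mulrDr -[P a * W a b * log2 _]mulrA lerD2l.
apply: (le_trans (ler_wpM2l _ (log2_le_subr1 _ (divr_gt0 Qb qb)))).
  by rewrite mulr_ge0.
rewrite mulrCA ler_wpM2l ?invr_ge0 ?(ltW ln2_gt0) //.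
by rewrite /D mulrBr mulr1 mulrA mulrAC.
Qed.

Lemma leq_max_sum (n : nat) (y : bitseq) :
  (max_occurrences n y <= max_sum n (size y))%N.
Proof. by rewrite /max_sum (bigD1 (in_tuple y)) //= leq_addr. Qed.

(** In W(y|x) / Q(y) the counts enter as #(x,y) / M(y), which is at most 1. What remains depends on
    [y] only through its length, whose law is the same for all [x], so averaging over [P] changes
    nothing. *)
Lemma mutual_info_deletion_le {R : realType} (d : R) (n : nat)
    (P : n.-tuple bool -> R) : 0 < d < 1 -> is_pmf P ->
  mutual_info (joint_pmf P (@deletion_channel R d n)) <=
  pattern_mean d n (fun k =>
    log2 (n.+1%:R * (max_sum n k)%:R * (d ^+ (n - k) * (1 - d) ^+ k))).
Proof.
move=> /andP[d0 d1] Ppmf; have d01 : 0 <= d <= 1 by rewrite !ltW.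
have d1' : 0 < 1 - d by rewrite subr_gt0.
(* The distribution Q; the factor [n.+1] counts the lengths 0 to [n]. *)
pose F (y : bitseq) : R :=
  (max_occurrences n y)%:R / (n.+1%:R * (max_sum n (size y))%:R).
have F1 : \sum_(y : n.-bseq bool) F y = 1.
  rewrite sum_bseq (eq_bigr (fun=> n.+1%:R^-1)) => [|k _].
    by rewrite sumr_const card_ord -[LHS]mulr_natl divff.
  transitivity (\sum_(y : k.-tuple bool) ((max_occurrences n y)%:R : R) /
      (n.+1%:R * (max_sum n k)%:R)).
    by apply: eq_bigr => y _; rewrite /F size_tuple.
  rewrite -mulr_suml -natr_sum -/(max_sum n k).
  have S0 : (max_sum n k)%:R != 0 :> R.
    by rewrite pnatr_eq0 -lt0n max_sum_gt0 // -ltnS.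
  by field; rewrite S0 nat1r pnatr_eq0.
have occ_gt0 (x : n.-tuple bool) (y : n.-bseq bool) :
    0 < deletion_channel d x y -> (0 < occurrences x y)%N.
  by rewrite deletion_channelE lt0n; case: eqP => // ->; rewrite mul0r ltxx.
have max_gt0 (x : n.-tuple bool) (y : n.-bseq bool) :
    0 < deletion_channel d x y ->
    (0 < max_occurrences n y)%N /\ (0 < max_sum n (size y))%N.
  move=> /occ_gt0 o; have M0 : (0 < max_occurrences n y)%N.
    by apply: leq_trans o _; apply: leq_max_occurrences; exact: size_tuple.
  by split=> //; apply: leq_trans M0 (leq_max_sum _ _).
apply: (le_trans (mutual_info_le P (@deletion_channel R d n) (fun y => F y)
  Ppmf _ _ _ _ _)).
- by move=> x y; exact: deletion_channel_ge0.
(* The channel has total mass 1: this is the mean of the constant 1, the affine case of slope 0. *)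
- move=> x; have := deletion_channel_mean d x (fun=> 1).
  under eq_bigr do rewrite mulr1.
  move=> ->; have := pattern_mean_affine d n 0 1.
  rewrite mul0r add0r => {2}<-; congr (pattern_mean _ _ _).
  by apply/funext => k; rewrite mul0r add0r.
- by move=> y; rewrite divr_ge0 ?mulr_ge0.
- by rewrite F1.
- move=> x y /max_gt0[M0 S0].
  by rewrite divr_gt0 ?mulr_gt0 ?ltr0n.
set g := fun k => log2 _.
rewrite -[leRHS]mul1r -(proj2 Ppmf) mulr_suml.
apply: ler_sum => x _; apply: ler_wpM2l; first exact: (proj1 Ppmf).
rewrite -(deletion_channel_mean d x); apply: ler_sum => y _.
have := deletion_channel_ge0 x y d01; rewrite le_eqVlt => /predU1P[<-|W0].
  by rewrite !mul0r.
apply: ler_wpM2l; first exact: ltW.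
have [M0 S0] := max_gt0 _ _ W0; have := occ_gt0 _ _ W0 => o0.
apply: le_log2.
  by rewrite !(mulr_gt0, invr_gt0, ltr0n).
have oM : (occurrences x y)%:R / (max_occurrences n y)%:R <= 1 :> R.
  rewrite ler_pdivrMr ?ltr0n // mul1r ler_nat.
  by apply: leq_max_occurrences; exact: size_tuple.
have -> : deletion_channel d x y / F y =
    (occurrences x y)%:R / (max_occurrences n y)%:R *
    (n.+1%:R * (max_sum n (size y))%:R * (d ^+ (n - size y) * (1 - d) ^+ size y)).
  rewrite deletion_channelE /F; field.
  by rewrite nat1r !pnatr_eq0 -!lt0n M0 S0.
by rewrite ler_piMl // !mulr_ge0 ?exprn_ge0 // ltW.
Qed.

Lemma log2_max_sum_lipschitz {R : realType} (n k m : nat) :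
  (0 < n)%N -> (k <= n)%N -> (m <= n)%N ->
  log2 (max_sum n k)%:R <=
  log2 (max_sum n m)%:R + `|k%:R - m%:R| * log2 (n.*2)%:R :> R.
Proof.
move=> n0 kn mn.
have S0 j : (j <= n)%N -> 0 < (max_sum n j)%:R :> R.
  by move=> jn; rewrite ltr0n max_sum_gt0.
have -> : `|k%:R - m%:R| = ((k - m) + (m - k))%:R :> R.
  have [mk|/ltnW km] := leqP m k.
    by rewrite ger0_norm ?subr_ge0 ?ler_nat // -natrB // (eqP mk) addn0.
  by rewrite ler0_norm ?subr_le0 ?ler_nat // opprB -natrB // (eqP km).
have n2 : 0 < (n.*2)%:R :> R by rewrite ltr0n double_gt0.
rewrite -log2X // addrC -log2M ?exprn_gt0 ?S0 //; apply: le_log2; first exact: S0.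
by rewrite -natrX -natrM ler_nat max_sum_lipschitz.
Qed.

(** The logarithm is majorized by a quadratic in [k], whose binomial mean is known exactly, so no
    tail estimate is required. *)
Lemma mutual_info_deletion_bound {R : realType} (d : R) (n m : nat)
    (P : n.-tuple bool -> R) :
  0 < d < 1 -> (0 < n)%N -> (m <= n)%N -> `|m%:R - n%:R * (1 - d)| <= 1 ->
  is_pmf P ->
  mutual_info (joint_pmf P (@deletion_channel R d n)) <=
  log2 (max_sum n m)%:R - n%:R * binary_entropy d
  + log2 (n.*2)%:R * (Num.sqrt n%:R + 2).
Proof.
move=> d01 n0 mn mu Ppmf.
apply: (le_trans (mutual_info_deletion_le d n P d01 Ppmf)).
move: d01 => /andP[d0 d1]; have d1' : 0 < 1 - d by rewrite subr_gt0.
set L := log2 (n.*2)%:R; set s := Num.sqrt n%:R.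
have n0R : 0 < n%:R :> R by rewrite ltr0n.
have s0 : 0 < s by rewrite sqrtr_gt0.
have ss : s ^+ 2 = n%:R by rewrite sqr_sqrtr // ltW.
have L0 : 0 <= L.
  rewrite /L /log2 divr_ge0 ?(ltW ln2_gt0) // ln_ge0 // ler1n.
  by rewrite double_gt0.
(* The slope in [k] of log(d^(n-k) (1-d)^k); its constant term [n%:R * log2 d] goes into [b]. At the
   mean [n (1 - d)] the two add up to [- n h(d)]. *)
pose a := log2 (1 - d) - log2 d.
pose b := L + log2 (max_sum n m)%:R + n%:R * log2 d + L * (s / 2 + 1).
pose f k : R := (a * k%:R + b) + L / (2 * s) * (k%:R - n%:R * (1 - d)) ^+ 2.
apply: (@le_trans _ _ (pattern_mean d n f)); last first.
  rewrite /f pattern_meanD pattern_meanZ pattern_mean_affine pattern_mean_sqr.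
  (* The variance costs at most [L * s / 2], as [n = s ^+ 2] and [d (1 - d) <= 1]. With
     [L + L * (s / 2 + 1)] from [b], the overhead is [L * (s + 2)]. *)
  have h : L / (2 * s) * (n%:R * d * (1 - d)) <= L * s / 2.
    rewrite -ss (_ : L / (2 * s) * _ = L * s / 2 * (d * (1 - d))); last first.
      by field; rewrite gt_eqF.
    apply: ler_piMr; last by nra.
    by rewrite divr_ge0 // mulr_ge0 // ltW.
  rewrite subrr expr0n /= addr0 /a /b /binary_entropy.
  by move: h; lra.
apply: le_pattern_mean => [|k kn]; first by rewrite !ltW.
have Sk : 0 < (max_sum n k)%:R :> R by rewrite ltr0n max_sum_gt0.
rewrite !log2M ?mulr_gt0 ?exprn_gt0 // !log2X // natrB //.
(* The price of the uniform choice of length is absorbed in [L] because [n + 1 <= 2n]. *)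
have hL : log2 n.+1%:R <= L.
  by apply: le_log2; rewrite ?ltr0n // ler_nat -addnn -addn1 leq_add2l.
have hS := @log2_max_sum_lipschitz R n k m n0 kn mn.
pose t : R := k%:R - n%:R * (1 - d).
have hk : `|k%:R - m%:R| <= `|t| + 1 :> R.
  rewrite (_ : k%:R - m%:R = t - (m%:R - n%:R * (1 - d))); last by rewrite /t; ring.
  by rewrite (le_trans (ler_normB _ _)) // lerD2l.
(* AM-GM *)
have ht : `|t| <= s / 2 + t ^+ 2 / (2 * s).
  rewrite -(real_normK (num_real t)) -subr_ge0.
  rewrite (_ : _ - _ = (s - `|t|) ^+ 2 / (2 * s)).
    by rewrite divr_ge0 ?sqr_ge0 // mulr_ge0 // ltW.
  by field; rewrite gt_eqF.
have hLk : L * `|k%:R - m%:R| <= L * (s / 2 + t ^+ 2 / (2 * s) + 1).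
  by apply: ler_wpM2l => //; apply: (le_trans hk); rewrite lerD2r.
have e : L / (2 * s) * t ^+ 2 = L * (t ^+ 2 / (2 * s)) by rewrite mulrAC mulrA.
rewrite /f -/t e /a /b; move: hS hL hLk; rewrite -/L; lra.
Qed.

(** * Vanishing overhead and passage to the limit inferior *)

(** With [s] the fourth root of [n], the logarithm is at most [C * s] and the other factor at most
    [3 * s ^+ 2], so the quotient by [n = s ^+ 4] is at most [3 * C / s]. *)
Lemma overhead_small {R : realType} (e : R) : 0 < e ->
  exists N : nat, forall n : nat, (N <= n)%N -> (0 < n)%N ->
  n%:R^-1 * (log2 (n.*2)%:R * (Num.sqrt n%:R + 2)) <= e.
Proof.
(* [C] comes from [log2 (2 * s ^+ 4) = 1 + 4 * log2 s], with [log2 s <= (s - 1) / ln 2] and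
   [1 <= s]. *)
move=> e0; pose C : R := 1 + 4 / ln 2.
have C0 : 0 < C by rewrite addr_gt0 // divr_gt0 // ln2_gt0.
pose A := 3 * C / e; have A0 : 0 < A by rewrite divr_gt0 // mulr_gt0.
(* This threshold gives [A ^+ 4 <= n], hence [A <= s], which is [3 * C / s <= e]. *)
exists (Num.truncn (A ^+ 4)).+1 => n Nn n0.
pose s : R := Num.sqrt (Num.sqrt n%:R).
have s2 : s ^+ 2 = Num.sqrt n%:R by rewrite sqr_sqrtr // sqrtr_ge0.
have s4 : s ^+ 4 = n%:R by rewrite -[4%N]/(2 * 2)%N exprM s2 sqr_sqrtr.
have s_ge0 : 0 <= s by rewrite sqrtr_ge0.
have sA : A <= s.
  rewrite -(@ler_pXn2r _ 4) ?nnegrE ?(ltW A0) // s4.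
  apply: ltW; apply: lt_le_trans (_ : (Num.truncn (A ^+ 4)).+1%:R <= _).
    exact: truncnS_gt.
  by rewrite ler_nat.
have s1 : 1 <= s.
  by rewrite -(@ler_pXn2r _ 4) ?nnegrE // s4 expr1n ler1n.
have s0 : 0 < s by apply: lt_le_trans s1.
have hlog : log2 (n.*2)%:R <= C * s.
  rewrite -mul2n natrM log2M ?ltr0n // -s4 log2X //.
  have -> : log2 2 = 1 :> R by rewrite /log2 divff // gt_eqF // ln2_gt0.
  have := log2_le_subr1 s s0; rewrite /C.
  have := @ln2_gt0 R; rewrite -invr_gt0; move: (ln 2)^-1 => l l0 h.
  have : l * s >= 0 by rewrite mulr_ge0 // ltW.
  nra.
rewrite -s2 -s4 ler_pdivrMl ?exprn_gt0 //.
apply: (@le_trans _ _ (C * s * (3 * s ^+ 2))).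
  apply: (@le_trans _ _ (C * s * (s ^+ 2 + 2))).
    by rewrite ler_wpM2r // addr_ge0 // exprn_ge0.
  rewrite ler_wpM2l ?mulr_ge0 ?(ltW C0) //.
  have : 1 <= s ^+ 2 by rewrite exprn_ege1.
  lra.
rewrite (_ : C * s * (3 * s ^+ 2) = s ^+ 3 * (3 * C)); last by ring.
rewrite (_ : s ^+ 4 * e = s ^+ 3 * (s * e)); last by ring.
by rewrite ler_wpM2l ?exprn_ge0 // -ler_pdivrMr.
Qed.

(** The limit inferior is the limit of the tail infima, which compare from index [N] on. *)
Lemma le_limn_einf {R : realType} (u v : nat -> \bar R) (N : nat) :
  (forall n, (N <= n)%N -> (u n <= v n)%E) ->
  (limn_einf u <= limn_einf v)%E.
Proof.
move=> uv; rewrite !limn_einf_lim.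
apply: lee_lim; [exact: is_cvg_einfs | exact: is_cvg_einfs |].
exists N => // n /= Nn; apply: le_ereal_inf_tmp => _ [k /= nk <-].
apply: le_trans (uv k (leq_trans Nn nk)).
by apply: ereal_inf_lbound; exists k.
Qed.

Lemma typical_lengthP {R : realType} (d : R) (n : nat) : 0 < d < 1 ->
  (typical_length d n <= n)%N /\
  `|(typical_length d n)%:R - n%:R * (1 - d)| <= 1.
Proof.
move=> /andP[d0 d1]; have x0 : 0 <= n%:R * (1 - d).
  by rewrite mulr_ge0 // subr_ge0 ltW.
have xn : n%:R * (1 - d) <= n%:R by rewrite ler_piMr // lerBlDr lerDl ltW.
have c0 : 0 <= Num.ceil (n%:R * (1 - d)).
  by rewrite ceil_ge0 (lt_le_trans _ x0) // ltrN10.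
have E : ((typical_length d n)%:R : R) = (Num.ceil (n%:R * (1 - d)))%:~R.
  by rewrite /typical_length natr_absz ger0_norm.
split.
  by rewrite -lez_nat /typical_length gez0_abs // ceil_le_int.
rewrite E; have := ceil_itv (n%:R * (1 - d)).
rewrite intrB => /andP[c1 c2]; rewrite ler_norml.
by apply/andP; split; lra.
Qed.

Theorem theorem3 (R : realType) (d : R) (hd0 : 0 < d) (hd1 : d < 1) :
  (deletion_capacity d <=
   limn_einf (fun n : nat =>
     (n%:R^-1 *
      log2 (\sum_(y : (typical_length d n).-tuple bool)
              \max_(x : n.-tuple bool) num_patterns x y)%N%:R)%:E)
   - (binary_entropy d)%:E)%E.
Proof.
have d01 : 0 < d < 1 by rewrite hd0.
have sumE n m : (\sum_(y : m.-tuple bool)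
    \max_(x : n.-tuple bool) num_patterns x y)%N = max_sum n m.
  apply: eq_bigr => y _; apply: eq_bigr => x _; exact: num_patternsE.
under [X in limn_einf X]eq_fun do rewrite sumE.
(* A slack [e] is granted to absorb the overhead. Both it and the entropy are moved under the limit
   inferior, leaving a comparison term by term. *)
apply/lee_addgt0Pr => e e0.
rewrite -addeA addeC -EFinN -EFinD -limn_einf_shift //.
have [N hN] := overhead_small e e0.
(* Starting at [N.+1] rather than [N] ensures [0 < n], so that [n] can be cancelled. *)
apply: (@le_limn_einf _ _ _ N.+1) => n Nn.
have n0 : (0 < n)%N by apply: leq_trans Nn.
have nV0 : 0 <= n%:R^-1 :> R by rewrite invr_ge0.
have [mn mu] := typical_lengthP d n d01.
set X := log2 _.
apply: (@le_trans _ _ ((n%:R^-1)%:E * (X - n%:R * binary_entropy d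
  + log2 (n.*2)%:R * (Num.sqrt n%:R + 2))%:E)%E).
  (* The bound does not depend on [P], so it passes to the supremum over input distributions. *)
  apply: lee_wpmul2l; first by rewrite lee_fin.
  apply: ge_ereal_sup => _ [P /= Ppmf <-]; rewrite lee_fin.
  exact: mutual_info_deletion_bound.
rewrite -EFinM -EFinD lee_fin mulrDr mulrBr mulKf ?pnatr_eq0 -?lt0n //.
have := hN n (ltnW Nn) n0; lra.
Qed.
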